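(* Let $E_{579}$ be the set of odd integers $v \ge 5$ for which there does not exist a $\mathrm{PBD}(v,\{5,7,9\})$. Then for every odd integer $v \ge 5$ with $v \notin E_{579}$, there exists a $\mathrm{TS}_3(v)$ whose incidence matrix $N_2$ is nonsingular over $\mathbb{R}$.
   Context: Hypergraphs are finite and may have repeated edges (the edges form a multiset of subsets of the vertex set). For positive integers $v,\lambda$ and $K \subseteq \{2,3,4,\dots\}$, a pairwise balanced design $\mathrm{PBD}_\lambda(v,K)$ is a hypergraph $(V,\mathcal{B})$ with $|V|=v$, all edge sizes belonging to $K$, such that any two distinct vertices appear together in exactly $\lambda$ edges (counted with multiplicity). Vertices are called points and edges are called blocks. Not every size in $K$ need be used. $\mathrm{PBD}(v,K)$ means $\mathrm{PBD}_1(v,K)$. A $\lambda$-fold triple system $\mathrm{TS}_\lambda(v)$ is a $\mathrm{PBD}_\lambda(v,\{3\})$. For a hypergraph $(V,\mathcal{B})$, the matrix $N_2$ is the zero-one matrix with rows indexed by the 2-subsets $S$ of $V$, columns indexed by the blocks $e \in \mathcal{B}$ (with multiplicity), and entry $N_2(S,e)=1$ if $S \subseteq e$ and $0$ otherwise. A $\mathrm{TS}_3(v)$ has exactly $\binom{v}{2}$ blocks, so its $N_2$ is square of order $\binom{v}{2}$. *)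

(* Defs.v *)
From mathcomp Require Import all_boot all_order all_algebra.
From mathcomp Require Import reals.

Set Implicit Arguments.
Unset Strict Implicit.
Unset Printing Implicit Defensive.

Import GRing.Theory.
Local Open Scope ring_scope.

(* The multiset of blocks is listed as a sequence: repetitions count, and the
   order matters only for the numbering of the columns of N2. *)
Record hypergraph := Hypergraph {
  point : finType;
  blocks : seq {set point}
}.

Definition is_PBD (lambda v : nat) (K : {pred nat}) (H : hypergraph) : Prop :=
  [/\ #|point H| = v,
      forall e, e \in blocks H -> #|e| \in K
    & forall x y : point H, x != y ->
        count (fun e : {set point H} => (x \in e) && (y \in e)) (blocks H)
        = lambda].

Definition is_TS (lambda v : nat) (H : hypergraph) : Prop :=
  is_PBD lambda v (pred1 3%N) H.

Definition pairs (V : finType) : {set {set V}} :=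
  [set S : {set V} | #|S| == 2%N].

Definition N2 (R : realType) (H : hypergraph) :
    'M[R]_(#|pairs (point H)|, size (blocks H)) :=
  \matrix_(i, j)
    (@enum_val _ (pairs (point H)) i \subset tnth (in_tuple (blocks H)) j)%:R.

(* Squareness of N2 is a theorem rather than a conversion, so the equality of
   the two dimensions is part of nonsingularity. *)
Definition nonsingular (R : realType) (m n : nat) (A : 'M[R]_(m, n)) : Prop :=
  exists e : m = n, castmx (e, erefl n) A \in unitmx.

Definition E579 (v : nat) : Prop :=
  [/\ odd v, (5 <= v)%N
    & ~ exists H : hypergraph, is_PBD 1 v (pred3 5 7 9)%N H].

(* Main.v *)
Require Import Defs.
From mathcomp Require Import all_boot all_order all_algebra.
From mathcomp Require Import reals.
From mathcomp Require Import boolp lra.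

Set Implicit Arguments.
Unset Strict Implicit.
Unset Printing Implicit Defensive.

Import GRing.Theory.
Local Open Scope ring_scope.

(** The idea is that nonsingular threefold triple systems can be glued along a
pairwise balanced design of index one.  Given a PBD(v, {5,7,9}), put on each
block B a TS_3(|B|) with nonsingular N_2.  A pair of points lies in a single
block B, so it is covered three times by the triples inside B and by no other
triple: the union is a TS_3(v).  For the same reason N_2 of the union is, up to
the order of rows and columns, block diagonal with the small matrices on its
diagonal, hence nonsingular.

Block matrices are avoided by reading nonsingularity as a uniqueness property.
A TS_3(v) has as many triples as pairs of points ([TS3_size]), so N_2 is
nonsingular as soon as a weighting of the pairs that sums to zero on each triple
must vanish ([separating_nonsingular]).  This property is local, and it passes
from the blocks of the design to the union at once ([PBD_fill]).

What remains is one system on each of 5, 7 and 9 points, where the uniqueness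
property is a homogeneous linear system of 10, 21 and 36 equations in as many
unknowns with rational coefficients, solved by elimination
([triple5_separating], [triple7_separating], [triple9_separating]).  Numbering
the points of a block carries these tables over to it ([table_fill]). *)

(** * Nonsingularity as a uniqueness property *)

Definition weight (R : realType) (V : finType) (g : {set V} -> R)
    (e : {set V}) : R :=
  \sum_(S in pairs V | S \subset e) g S.

(** For triples [s] inside [A], this is the linear independence of the rows of
N_2 that belong to the pairs inside [A].  The weighting [g] lives on all subsets
of [V], so that one and the same [g] can be tested on each block of a design. *)
Definition separating (R : realType) (V : finType) (A : {set V})
    (s : seq {set V}) : Prop :=
  forall g : {set V} -> R, {in s, forall e : {set V}, weight g e = 0} ->
  {in pairs V, forall S : {set V}, S \subset A -> g S = 0}.

Definition triples_on (V : finType) (A : {set V}) (s : seq {set V}) : Prop :=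
  {in s, forall e : {set V}, e \subset A /\ #|e| = 3%N} /\
  {in A &, forall x y : V, x != y ->
     count (fun e : {set V} => (x \in e) && (y \in e)) s = 3%N}.

Lemma castmx_unitmx (F : fieldType) (m n : nat) (A : 'M[F]_(m, n))
    (e : m = n) :
  (forall u : 'rV_m, u *m A = 0 -> u = 0) -> castmx (e, erefl n) A \in unitmx.
Proof.
case: n / e A => A kerA; rewrite castmx_id -row_free_unit.
exact: inj_row_free.
Qed.

Lemma pair_subset (V : finType) (x y : V) (e : {set V}) :
  ([set x; y] \subset e) = (x \in e) && (y \in e).
Proof. by rewrite subUset !sub1set. Qed.

(** Count the flags (pair, triple containing it): every pair is in three triples
and every triple contains three pairs. *)
Lemma TS3_size (V : finType) (s : seq {set V}) :
  triples_on [set: V] s -> #|pairs V| = size s.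
Proof.
move=> [card3 cov].
have flags e : e \in s -> (\sum_(S in pairs V) (S \subset e) = 3)%N.
  move=> /card3[_ e3]; rewrite -big_mkcondr sum1_card.
  have -> : 3%N = 'C(#|e|, 2) by rewrite e3.
  rewrite -cards_draws; apply: eq_card => S.
  by rewrite !inE [LHS]unfold_in inE andbC.
have: (\sum_(S in pairs V) \sum_(e <- s) (S \subset e) = size s * 3)%N.
  rewrite exchange_big /= big_seq (eq_bigr (fun=> 3%N) flags) -big_seq.
  by rewrite big_const_seq count_predT iter_addn_0 mulnC.
rewrite (eq_bigr (fun=> 3%N)) => [|S]; last first.
  rewrite inE => /cards2P[x [y [xy ->]]]; rewrite -(cov x y) ?inE //.
  by rewrite -big_mkcond sum1_count; apply: eq_count => e; rewrite pair_subset.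
by rewrite sum_nat_const => /eqP; rewrite eqn_pmul2r // => /eqP.
Qed.

(** A vector in the left kernel of N_2 is a weighting of the pairs whose sum
over each block is zero. *)
Lemma separating_nonsingular (R : realType) (H : hypergraph) :
  #|pairs (point H)| = size (blocks H) ->
  separating R [set: point H] (blocks H) -> nonsingular (N2 R H).
Proof.
move=> sz sepH; exists sz; apply: castmx_unitmx => u uN0.
case: (pickP (mem (pairs (point H)))) => [S0 S0P | no_pair]; last first.
  apply/rowP => i; case: (no_pair (enum_val i)) => /=.
  by rewrite enum_valP.
(* Outside the pairs, g takes the value of an arbitrary entry of u. *)
pose g S := u 0 (enum_rank_in S0P S).
have g0 : {in blocks H, forall e : {set point H}, weight g e = 0}.
  move=> e /(tnthP (in_tuple (blocks H)))[j ->].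
  move/rowP/(_ j): uN0; rewrite !mxE => <-.
  rewrite /weight big_mkcondr big_enum_val; apply: eq_bigr => i _ /=.
  by rewrite !mxE /g enum_valK_in; case: ifP => _; rewrite ?mulr1 ?mulr0.
apply/rowP => i; rewrite mxE.
by have := sepH g g0 _ (enum_valP i) (subsetT _); rewrite /g enum_valK_in.
Qed.

(** * Filling the blocks of a pairwise balanced design *)

(** Any two points are together in exactly one block, so both the covering
condition and the uniqueness property can be read off inside that block: the
systems in the other blocks never see the pair. *)
Lemma PBD_fill (R : realType) (v : nat) (K : {pred nat}) (H : hypergraph)
    (D : {set point H} -> seq {set point H}) :
  is_PBD 1 v K H ->
  {in blocks H, forall B : {set point H},
     triples_on B (D B) /\ separating R B (D B)} ->
  let s := flatten [seq D B | B <- blocks H] in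
  triples_on [set: point H] s /\ separating R [set: point H] s.
Proof.
move=> [_ _ cov1] DP s; split; first split.
- by move=> e /flatten_mapP[B /DP[[card3 _] _] /card3[_ e3]]; rewrite subsetT.
- move=> x y _ _ xy; rewrite count_flatten -map_comp sumnE big_map.
  transitivity (\sum_(B <- blocks H) 3 * ((x \in B) && (y \in B)))%N; last first.
    by rewrite -big_distrr -big_mkcond sum1_count cov1.
  rewrite [LHS]big_seq [RHS]big_seq; apply: eq_bigr => B /DP[[sub cov] _] /=.
  have [/andP[xB yB] | xyB] := boolP ((x \in B) && (y \in B)).
    by rewrite cov.
  apply/eqP; rewrite muln0 -leqn0 leqNgt -has_count; apply: contra xyB.
  by move=> /hasP[e /sub[/subsetP eB _] /andP[/eB -> /eB ->]].
- move=> g g0 S; rewrite inE => S2 _.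
  have /cards2P[x [y [xy defS]]] := S2.
  have: has (fun B : {set point H} => (x \in B) && (y \in B)) (blocks H).
    by rewrite has_count cov1.
  move=> /hasP[B BH]; rewrite -pair_subset -defS => SB.
  apply: (DP B BH).2 SB; rewrite ?inE // => e eD.
  by apply: g0; apply/flatten_mapP; exists B.
Qed.

(** * Three small systems *)

(** All ten triples.  If weights on the pairs sum to zero on every triple, then
combining the four triples of {a, b, c, d} gives the disjoint pairs ab and cd the
same weight.  Disjointness makes the ten pairs into the Petersen graph, which is
connected; so all weights are equal, hence zero. *)
Definition triple5 : seq (nat * nat * nat) :=
  [:: (0, 1, 2); (0, 1, 3); (0, 1, 4); (0, 2, 3); (0, 2, 4);
      (0, 3, 4); (1, 2, 3); (1, 2, 4); (1, 3, 4); (2, 3, 4)]%N.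

(** The progressions i, i + d, i + 2d modulo 7, first for d = 1, then 2, then 4.
Doubling permutes the differences 1, 2, 4 cyclically, which is why N_2 is
nonsingular: with a_i the weight of the pair i, i + 1, applying the equations
for d = 1, 2, 4 in turn gives a_i = - (a_i + a_0 + ... + a_6), so 2 a_i is
independent of i, and then all a_i vanish.  A Fano plane taken three times
would not do, as equal blocks give equal columns. *)
Definition triple7 : seq (nat * nat * nat) :=
  [:: (0, 1, 2); (1, 2, 3); (2, 3, 4); (3, 4, 5); (4, 5, 6); (0, 5, 6); (0, 1, 6);
      (0, 2, 4); (1, 3, 5); (2, 4, 6); (0, 3, 5); (1, 4, 6); (0, 2, 5); (1, 3, 6);
      (0, 1, 4); (1, 2, 5); (2, 3, 6); (0, 3, 4); (1, 4, 5); (2, 5, 6);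
      (0, 3, 6)]%N.

(** A system without evident symmetry, chosen because its matrix N_2 is
nonsingular: the determinant is 2304 up to sign. *)
Definition triple9 : seq (nat * nat * nat) :=
  [:: (0, 1, 2); (0, 1, 5); (0, 1, 8); (0, 2, 4); (0, 2, 5); (0, 3, 6);
      (0, 3, 7); (0, 3, 8); (0, 4, 6); (0, 4, 7); (0, 5, 6); (0, 7, 8);
      (1, 2, 6); (1, 2, 7); (1, 3, 4); (1, 3, 5); (1, 3, 6); (1, 4, 5);
      (1, 4, 8); (1, 6, 7); (1, 7, 8); (2, 3, 6); (2, 3, 7); (2, 3, 8);
      (2, 4, 5); (2, 4, 7); (2, 5, 8); (2, 6, 8); (3, 4, 5); (3, 4, 8);
      (3, 5, 7); (4, 6, 7); (4, 6, 8); (5, 6, 7); (5, 6, 8); (5, 7, 8)]%N.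

Definition in_triple (i : nat) (t : nat * nat * nat) : bool :=
  i \in [:: t.1.1; t.1.2; t.2].

Definition TS3_table (n : nat) (T : seq (nat * nat * nat)) : bool :=
  all (fun t => uniq [:: t.1.1; t.1.2; t.2] &&
                all (gtn n) [:: t.1.1; t.1.2; t.2]) T &&
  all (fun i => all (fun j =>
    (i == j) || (count (fun t => in_triple i t && in_triple j t) T == 3%N))
    (iota 0 n)) (iota 0 n).

(** In the tables above each triple is increasing, hence [f] is only read at
pairs i < j and need not be symmetric. *)
Definition edge_sum (R : realType) (f : nat -> nat -> R)
    (t : nat * nat * nat) : R :=
  f t.1.1 t.1.2 + f t.1.1 t.2 + f t.1.2 t.2.

Definition separating_table (R : realType) (n : nat)
    (T : seq (nat * nat * nat)) : Prop :=
  forall f : nat -> nat -> R, {in T, forall t, edge_sum f t = 0} ->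
  forall i j, (i < j < n)%N -> f i j = 0.

(** For concrete [n] and [T], both the hypotheses and the conclusion evaluate to
finite conjunctions of linear equations between the values of [f]. *)
Lemma separating_tableP (R : realType) (n : nat) (T : seq (nat * nat * nat)) :
  (forall f : nat -> nat -> R, all (fun t => edge_sum f t == 0) T ->
     all (fun j => all (fun i => f i j == 0) (iota 0 j)) (iota 0 n)) ->
  separating_table R n T.
Proof.
move=> elim f f0 i j /andP[ij jn].
have /elim/allP/(_ j): all (fun t => edge_sum f t == 0) T.
  by apply/allP => t /f0/eqP.
rewrite mem_iota jn => /(_ isT)/allP/(_ i).
by rewrite mem_iota ij => /(_ isT)/eqP.
Qed.

(** The values of the weighting are the unknowns of [lra], which finds for each
of them a rational combination of the equations of the table. *)
Ltac eliminate :=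
  apply: separating_tableP => f; rewrite /edge_sum /=;
  repeat (move=> /andP[/eqP ?]); move=> _;
  repeat (apply/andP; split); try exact: isT; apply/eqP; lra.

Lemma triple5_separating (R : realType) : separating_table R 5 triple5.
Proof. eliminate. Qed.

Lemma triple7_separating (R : realType) : separating_table R 7 triple7.
Proof. eliminate. Qed.

Lemma triple9_separating (R : realType) : separating_table R 9 triple9.
Proof. eliminate. Qed.

Lemma pair_neq (V : finType) (a b c d : V) :
  a != c -> a != d -> [set a; b] != [set c; d].
Proof.
move=> ac ad; apply: contraNneq ac => /setP/(_ a).
by rewrite !inE eqxx (negPf ad) orbF => /esym.
Qed.

(** This links the weight of a block to the three-term sums of the tables. *)
Lemma weight_triple (R : realType) (V : finType) (g : {set V} -> R)
    (x y z : V) : uniq [:: x; y; z] ->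
  weight g [set x; y; z] = g [set x; y] + g [set x; z] + g [set y; z].
Proof.
rewrite /= !inE negb_or andbT => /andP[/andP[xy xz] yz].
have -> : weight g [set x; y; z] =
    \sum_(S in [set x; y] |: ([set x; z] |: [set [set y; z]])) g S.
  apply: eq_bigl => S; rewrite !inE; apply/andP/idP => [[]|]; last first.
    by case/or3P => /eqP->;
      rewrite cards2 pair_subset ?xy ?xz ?yz !inE !eqxx ?orbT.
  move=> /cards2P[a [b [ab ->]]]; rewrite pair_subset !inE -!orbA.
  move=> /andP[/or3P[]/eqP ea /or3P[]/eqP eb]; move: ab;
    rewrite ea eb ?eqxx // ?[[set y; x]]setUC ?[[set z; x]]setUC
      ?[[set z; y]]setUC ?eqxx ?orbT //.
rewrite !big_setU1 ?big_set1 /= ?addrA // !inE ?negb_or.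
  by rewrite pair_neq.
apply/andP; split; last exact: pair_neq.
by rewrite [[set x; y]]setUC pair_neq // eq_sym.
Qed.

Lemma table_fill (R : realType) (n : nat) (T : seq (nat * nat * nat))
    (V : finType) (A : {set V}) :
  TS3_table n T -> separating_table R n T -> (0 < n)%N -> #|A| = n ->
  exists s, triples_on A s /\ separating R A s.
Proof.
move=> /andP[/allP Tok /allP Tcov] sepT n_gt0 An.
have [x0 _] : exists x, x \in A by apply/card_gt0P; rewrite An.
pose p := nth x0 (enum A).
have szA : size (enum A) = n by rewrite -cardE.
have pA i : (i < n)%N -> p i \in A.
  by move=> lt_in; rewrite -mem_enum mem_nth ?szA.
have p_eq i j : (i < n)%N -> (j < n)%N -> (p i == p j) = (i == j).
  by move=> lt_in lt_jn; rewrite nth_uniq ?szA ?enum_uniq.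
have p_surj x : x \in A -> exists2 i, (i < n)%N & x = p i.
  by rewrite -mem_enum => /(nthP x0)[i]; rewrite szA; exists i.
pose tri t := [set p t.1.1; p t.1.2; p t.2].
have Tlt t : t \in T -> [/\ t.1.1 < n, t.1.2 < n & t.2 < n]%N.
  by move=> /Tok/andP[_] /and4P[].
have tri_uniq t : t \in T -> uniq [:: p t.1.1; p t.1.2; p t.2].
  move=> tT; have [lt1 lt2 lt3] := Tlt t tT.
  by have /andP[+ _] := Tok t tT; rewrite /= !inE !p_eq.
have mem_tri i t : (i < n)%N -> t \in T -> (p i \in tri t) = in_triple i t.
  move=> lt_in tT; have [lt1 lt2 lt3] := Tlt t tT.
  by rewrite /in_triple !inE !p_eq // orbA.
exists [seq tri t | t <- T]; split; first split.
- move=> _ /mapP[t tT ->]; have [lt1 lt2 lt3] := Tlt t tT; split.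
    by rewrite !subUset !sub1set !pA.
  apply: etrans (card_uniqP (tri_uniq t tT)).
  by apply: eq_card => x; rewrite !inE orbA.
- move=> _ _ /p_surj[i lt_in ->] /p_surj[j lt_jn ->]; rewrite p_eq // => ij.
  have /Tcov/allP/(_ j) : i \in iota 0 n by rewrite mem_iota.
  rewrite mem_iota lt_jn (negPf ij) => /(_ isT)/eqP <-.
  by rewrite count_map; apply: eq_in_count => t tT /=; rewrite !mem_tri.
- move=> g g0 S; rewrite inE => /cards2P[x [y [xy ->]]].
  rewrite pair_subset => /andP[/p_surj[i lt_in xi] /p_surj[j lt_jn yj]].
  have {}sepT : forall i j, (i < j < n)%N -> g [set p i; p j] = 0.
    apply: (sepT (fun i j => g [set p i; p j])) => t tT.
    by rewrite /edge_sum -weight_triple ?tri_uniq //; apply/g0/(map_f tri).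
  move: xy; rewrite xi yj p_eq // neq_ltn => /orP[ij|ji].
    by rewrite sepT // ij.
  by rewrite setUC sepT // ji.
Qed.

Lemma block_fill (R : realType) (V : finType) (A : {set V}) :
  #|A| \in (pred3 5 7 9)%N -> exists s, triples_on A s /\ separating R A s.
Proof.
rewrite !inE => /or3P[]/eqP.
- exact: (@table_fill _ 5 triple5 _ _ isT (@triple5_separating R)).
- exact: (@table_fill _ 7 triple7 _ _ isT (@triple7_separating R)).
- exact: (@table_fill _ 9 triple9 _ _ isT (@triple9_separating R)).
Qed.

Theorem theorem1p1 (R : realType) (v : nat) (v_odd : odd v) (v_ge5 : (5 <= v)%N)
    (vE : ~ E579 v) :
  exists H : hypergraph, is_TS 3 v H /\ nonsingular (N2 R H).
Proof.
have [H HP] : exists H : hypergraph, is_PBD 1 v (pred3 5 7 9)%N H.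
  by apply: contrapT => noH; apply: vE.
have [Hv HK _] := HP.
have /choice[D DP] : forall B : {set point H}, exists s, B \in blocks H ->
    triples_on B s /\ separating R B s.
  move=> B; have [BH | _] := boolP (B \in blocks H); last by exists [::].
  by have [s sP] := block_fill R (HK B BH); exists s.
have [tri sep] := PBD_fill HP DP.
exists (Hypergraph (flatten [seq D B | B <- blocks H])); split.
  split=> //= [e /tri.1[_ e3] | x y]; first by rewrite inE e3.
  by apply: tri.2; rewrite inE.
by apply: separating_nonsingular => //=; apply: TS3_size.
Qed.
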